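(* Let $q$ be a prime power, fix positive integers $n,k$, and for an integer $\ell\ge0$ let $c=n-k-\ell$ (the number of maximally entangled pairs required by the entanglement-assisted quantum code associated to an $[n,k]_{q^2}$ code with Hermitian hull dimension $\ell$). For $\ell+1\le k\le n-\ell-1$, the number $A^H_{n,k,\ell,q}$ of such classical codes satisfies $$A^H_{n,k,\ell,q}=\alpha^H_{n,k,\ell,q}\,(q^{\ell+1}-1)\,A^H_{n,k,\ell+1,q},\qquad \alpha^H_{n,k,\ell,q}=\frac{q^{n-2\ell-1}(q^{\ell+1}+1)}{(q^{a}-(-1)^{a})(q^{b}-(-1)^{b})},$$ where $a=k-\ell$ and $b=n-k-\ell$. Moreover, outside the boundary family consisting of $\ell=0$, $n$ even and $(q,k)\in\{(2,1),(2,n-1)\}$, $A^H_{n,k,\ell,q}$ is strictly decreasing in $\ell$ (equivalently, strictly increasing in $c$); that is, $A^H_{n,k,\ell,q}>A^H_{n,k,\ell+1,q}$ for all such parameters not in the boundary family.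
   Context: For a prime power $q$, the Hermitian inner product on $\mathbb{F}_{q^2}^n$ is $\langle \mathbf{x},\mathbf{y}\rangle_H=\sum_{i=1}^n x_i y_i^q$. For an $\mathbb{F}_{q^2}$-linear subspace $C\subseteq\mathbb{F}_{q^2}^n$, its Hermitian dual is $C^{\perp_H}=\{\mathbf{y}\in\mathbb{F}_{q^2}^n:\langle\mathbf{x},\mathbf{y}\rangle_H=0\ \forall\mathbf{x}\in C\}$ and its Hermitian hull is $\mathrm{Hull}_H(C)=C\cap C^{\perp_H}$. An $[n,k]_{q^2}$ code is a $k$-dimensional subspace of $\mathbb{F}_{q^2}^n$. The number $A^H_{n,k,\ell,q}$ is the number of $k$-dimensional $\mathbb{F}_{q^2}$-subspaces $C\subseteq\mathbb{F}_{q^2}^n$ with $\dim\mathrm{Hull}_H(C)=\ell$. By the Guenda–Jitman–Gulliver construction, an $[n,k]_{q^2}$ code with Hermitian hull dimension $\ell$ gives an entanglement-assisted quantum error-correcting code of length $n$ using $c=n-k-\ell$ maximally entangled pairs; in this statement only the numerical value $c=n-k-\ell$ is used, as a relabelling of $\ell$. *)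

(* Defs.v *)
From HB Require Import structures.
From mathcomp Require Import all_boot all_order all_algebra all_field.

Set Implicit Arguments.
Unset Strict Implicit.
Unset Printing Implicit Defensive.

Import GRing.Theory.
Local Open Scope ring_scope.

(* A subspace is stored as its canonical matrix, hence there are finitely many
   over a finite field; this is what lets #|_| count codes. *)
HB.instance Definition _ (F : finFieldType) (vT : vectType F) :=
  CanIsCountable (@VectorInternalTheory.vs2mxK F vT).
HB.instance Definition _ (F : finFieldType) (vT : vectType F) :=
  (@CanIsFinite {vspace vT} _ _ _ (@VectorInternalTheory.vs2mxK F vT)
   : isFinite {vspace vT}).

Definition prime_power (q : nat) : Prop :=
  exists p e : nat, [/\ prime p, (0 < e)%N & q = (p ^ e)%N].

Section HermitianHull.

Variables (F : finFieldType) (q n : nat).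
Implicit Types (x y : 'rV[F]_n) (C : {vspace 'rV[F]_n}).

(* The Hermitian inner product when #|F| = q ^ 2. *)
Definition herm x y : F := \sum_(i < n) x 0 i * y 0 i ^+ q.

Definition hperp C : {set 'rV[F]_n} :=
  [set y | [forall x in C, herm x y == 0]].

(* When #|F| = q ^ 2 the set hperp C is already a subspace, so taking its span
   adds nothing: see memv_hdual. *)
Definition hdual C : {vspace 'rV[F]_n} := <<enum (hperp C)>>%VS.

Definition hhull C : {vspace 'rV[F]_n} := (C :&: hdual C)%VS.

Definition num_codes (k l : nat) : nat :=
  #|[set C : {vspace 'rV[F]_n} | (\dim C == k) && (\dim (hhull C) == l)]|.

(* c = n - k - l, as an integer so that nothing is truncated. *)
Definition ent_pairs C : int := n%:Z - (\dim C)%:Z - (\dim (hhull C))%:Z.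

Definition num_codes_pairs (k : nat) (c : int) : nat :=
  #|[set C : {vspace 'rV[F]_n} | (\dim C == k) && (ent_pairs C == c)]|.

Lemma memv_hdual C y : prime_power q -> #|F| = (q ^ 2)%N ->
  (y \in hdual C) = (y \in hperp C).
Proof.
move=> [p [e [p_pr e_gt0 Dq]]] cardF.
have charF : p \in [pchar F].
  by apply: (@card_finPcharP F p (e * 2)) => //; rewrite cardF Dq -expnM.
have qF : [pchar F].-nat q by rewrite Dq pnatX pnatE // charF.
have hermZD x a (u v : 'rV[F]_n) :
    herm x (a *: u + v) = a ^+ q * herm x u + herm x v.
  rewrite /herm mulr_sumr -big_split; apply: eq_bigr => i _ /=.
  by rewrite !mxE exprDn_pchar // exprMn mulrDr mulrCA.
have herm0 x : herm x 0 = 0.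
  apply: big1 => j _.
  by rewrite mxE expr0n Dq expn_eq0 !eqn0Ngt prime_gt0 // mulr0.
apply/idP/idP => [|Hy]; last by apply: memv_span; rewrite mem_enum.
move=> /coord_span ->; rewrite inE; apply/forall_inP => x Cx; apply/eqP.
apply: (big_ind (fun v => herm x v = 0)) => // [u v u0 v0|i _].
  by rewrite -[u]scale1r hermZD u0 v0 mulr0 addr0.
have /forall_inP/(_ x Cx)/eqP w0 :
    [forall x in C, herm x (in_tuple (enum (hperp C)))`_i == 0].
  have: (enum (hperp C))`_i \in enum (hperp C) by rewrite mem_nth // -cardE.
  by rewrite mem_enum inE.
by rewrite -[_ *: _]addr0 hermZD w0 herm0 mulr0 addr0.
Qed.

End HermitianHull.

(* The natural-number subtractions are exact when l < k and k + l < n. *)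
Definition alphaH (n k l q : nat) : rat :=
  let a := (k - l)%N in let b := (n - k - l)%N in
  q%:R ^+ (n - 2 * l - 1) * (q%:R ^+ (l + 1) + 1)
  / ((q%:R ^+ a - (-1) ^+ a) * (q%:R ^+ b - (-1) ^+ b)).

(* Main.v *)
Require Import Defs.
From HB Require Import structures.
From mathcomp Require Import all_boot all_order all_algebra all_field.
From mathcomp Require Import ring lra zify.

Set Implicit Arguments.
Unset Strict Implicit.
Unset Printing Implicit Defensive.

Import Order.TTheory GRing.Theory Num.Theory.
Local Open Scope ring_scope.

(** Write A(k, l) for the number of k-dimensional codes whose hull has dimension
    l, Q = q ^ 2, e(m) = (-1) ^ m, a = k - l and b = n - k - l.  The hull of C
    is the radical of the Hermitian form restricted to C, and the recurrence
    follows from two double counts, each of which compares codes of dimension k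
    with codes E of dimension k + 1 and hull dimension l.

    - Flags with an anisotropic vector ([sum_aniso]).  The pairs (E, u) with u
      in E and <u, u> nonzero correspond to the pairs (C, u) with C of
      dimension k and hull dimension l and u anisotropic in the dual of C:
      C is the hyperplane of E orthogonal to u, and E = C + <u>.  This links
      A(k + 1, l) to A(k, l).
    - Flags with an isotropic vector ([sum_oblique]).  The triples (E, u, v)
      with u, v in E, <u, u> = 0 and <u, v> nonzero correspond to the triples
      (C, u, v) with C of dimension k and hull dimension l + 1, u in the hull
      of C, and v any vector with <u, v> nonzero: again C is the hyperplane of
      E orthogonal to u, and E = C + <v>.  This links A(k + 1, l) to
      A(k, l + 1).

    Counting the fibres only requires the number N of anisotropic vectors in a
    space of dimension r + m with radical of dimension r ([card_aniso]):
    q N = Q ^ r q ^ m (q ^ m - e(m)) (q - 1).  That comes by induction on m from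
    splitting off an anisotropic vector, because a nonzero norm has exactly
    q + 1 preimages under t |-> t ^ (q + 1).  Eliminating A(k + 1, l) from the
    two links gives

      A(k, l) (q ^ a - e(a)) (q ^ b - e(b))
        = A(k, l + 1) q ^ (a + b - 1) (Q ^ (l + 1) - 1),

    which is the recurrence.  For strict monotonicity one needs that the
    denominator is smaller than the numerator, an elementary estimate
    ([signed_pow_bound]), and that the counts are nonzero.  No explicit code
    with a prescribed hull is constructed for that: by the recurrence
    A(k, 0), A(k, 1), ..., A(k, min(k, n - k)) all vanish or none does, and some
    k-dimensional code exists ([hull_count_gt0]). *)

Lemma signed_pow_gt0 (q m : nat) :
  (1 < q)%N -> 0 < q%:R ^+ m.+1 - (-1) ^+ m.+1 :> rat.
Proof.
move=> q1; rewrite subr_gt0; apply: (@le_lt_trans _ _ 1).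
  by rewrite -signr_odd; case: odd.
by rewrite -natrX (ltr_nat _ 1) -(exp1n m.+1) ltn_exp2r.
Qed.

Section HermitianGeometry.

Variables (F : finFieldType) (q n : nat).
Hypothesis q_pp : prime_power q.
Hypothesis cardF : #|F| = (q ^ 2)%N.

Implicit Types (u v w x y : 'rV[F]_n) (C E U W : {vspace 'rV[F]_n}).

Local Notation "''[' x , y ]" := (@herm F q n x y)
  (at level 0, format "''[' x ,  y ]").
Local Notation perp := (@hdual F q n).
Local Notation rad := (@hhull F q n).

Lemma q_gt1 : (1 < q)%N.
Proof.
have [p [e [p_pr e_gt0 ->]]] := q_pp.
exact: leq_trans (prime_gt1 p_pr) (leq_pexp2l (prime_gt0 p_pr) e_gt0).
Qed.

Lemma q_gt0 : (0 < q)%N. Proof. exact: ltnW q_gt1. Qed.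

(** * The Hermitian form and orthogonality *)

Lemma conj0 : 0 ^+ q = 0 :> F.
Proof. by rewrite expr0n eqn0Ngt q_gt0. Qed.

Lemma conjD (s t : F) : (s + t) ^+ q = s ^+ q + t ^+ q.
Proof.
have [p [e [p_pr e_gt0 Dq]]] := q_pp.
have charF : p \in [pchar F].
  by apply: (@card_finPcharP F p (e * 2)) => //; rewrite cardF Dq -expnM.
by apply: exprDn_pchar; rewrite Dq pnatX pnatE // charF.
Qed.

Lemma conjN (t : F) : (- t) ^+ q = - t ^+ q.
Proof. by apply/eqP; rewrite -addr_eq0 -conjD addNr conj0. Qed.

Lemma conj_sum I (r : seq I) (f : I -> F) :
  (\sum_(i <- r) f i) ^+ q = \sum_(i <- r) f i ^+ q.
Proof. exact: (big_morph (fun t => t ^+ q) conjD conj0). Qed.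

Lemma conjK (t : F) : t ^+ q ^+ q = t.
Proof. by rewrite -exprM mulnn -cardF expf_card. Qed.

Lemma hermC x y : '[y, x] = '[x, y] ^+ q.
Proof.
rewrite /herm conj_sum; apply: eq_bigr => i _.
by rewrite exprMn conjK mulrC.
Qed.

Lemma hermDl x y w : '[x + y, w] = '[x, w] + '[y, w].
Proof.
by rewrite /herm -big_split; apply: eq_bigr => i _; rewrite /= mxE mulrDl.
Qed.

Lemma hermZl (t : F) x w : '[t *: x, w] = t * '[x, w].
Proof.
by rewrite /herm mulr_sumr; apply: eq_bigr => i _; rewrite mxE mulrA.
Qed.

Lemma hermDr x y w : '[w, x + y] = '[w, x] + '[w, y].
Proof. by rewrite hermC hermDl conjD -!hermC. Qed.

Lemma hermZr (t : F) x w : '[w, t *: x] = t ^+ q * '[w, x].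
Proof. by rewrite hermC hermZl exprMn -hermC. Qed.

Lemma herm0l x : '[0, x] = 0.
Proof. by rewrite -(scale0r 0) hermZl mul0r. Qed.

Lemma hermNl x w : '[- x, w] = - '[x, w].
Proof. by rewrite -scaleN1r hermZl mulN1r. Qed.

Lemma herm_eq0C x y : ('[x, y] == 0) = ('[y, x] == 0).
Proof. by rewrite (hermC x y) expf_eq0 q_gt0. Qed.

Lemma herm_norm_fix x : '[x, x] ^+ q = '[x, x].
Proof. by rewrite -hermC. Qed.

Lemma perpP C y : reflect {in C, forall x, '[x, y] = 0} (y \in perp C).
Proof.
rewrite memv_hdual // inE.
by apply: (iffP forall_inP) => Cy x Cx; apply/eqP; rewrite Cy.
Qed.

Lemma perpE C x y : x \in C -> y \in perp C -> '[x, y] = 0.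
Proof. by move=> Cx /perpP->. Qed.

Lemma mem_perp_line u y : (y \in perp <[u]>) = ('[u, y] == 0).
Proof.
apply/perpP/eqP => [|uy x /vlineP[t ->]]; first by apply; exact: memv_line.
by rewrite hermZl uy mulr0.
Qed.

Lemma perpD U W : perp (U + W) = (perp U :&: perp W)%VS.
Proof.
apply/vspaceP => y; rewrite memv_cap.
apply/perpP/andP => [UWy | [Uy Wy] x /memv_addP[s Us [t Wt ->]]].
  split; apply/perpP => x Ax; apply: UWy.
    by rewrite -[x]addr0 memv_add ?mem0v.
  by rewrite -[x]add0r memv_add ?mem0v.
by rewrite hermDl (perpE Us) // (perpE Wt) // addr0.
Qed.

Lemma perp0 : perp 0%VS = fullv.
Proof.
by apply/vspaceP => y; rewrite memvf; apply/perpP => x /vlineP[t ->];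
   rewrite scaler0 herm0l.
Qed.

Lemma perpf : perp fullv = 0%VS.
Proof.
apply/vspaceP => y; rewrite memv0.
apply/idP/eqP => [/perpP Vy | ->]; last exact: mem0v.
apply/rowP => i; rewrite mxE -[LHS]conjK.
have := Vy (delta_mx 0 i) (memvf _).
rewrite /herm (bigD1 i) //= big1 => [|j /negPf ne_ji].
  by rewrite !mxE !eqxx mul1r addr0 => ->; rewrite conj0.
by rewrite !mxE ne_ji andbF mul0r.
Qed.

Lemma dim_cap_perp_line W u :
  (\dim (W :&: perp <[u]>) + (u \notin perp W) = \dim W)%N.
Proof.
pose g v : 'rV[F]_1 := \row__ '[v, u].
have g_lin : linear g.
  move=> t x y; apply/rowP => i; rewrite !mxE hermDl hermZl //.
pose gL := GRing.isLinear.Build _ _ _ _ g g_lin.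
pose g1 : {linear 'rV[F]_n -> 'rV[F]_1} := HB.pack g gL.
have kerE : lker (linfun g1) = perp <[u]>.
  apply/vspaceP => y; rewrite memv_ker lfunE /= mem_perp_line herm_eq0C.
  by apply/eqP/eqP => [/rowP/(_ 0)|yu]; [|apply/rowP => i]; rewrite !mxE.
rewrite -(limg_ker_dim (linfun g1) W) kerE; congr addn.
have [/perpP Wu | /perpP nWu] := boolP (u \in perp W).
  apply/esym/eqP; rewrite dimv_eq0 -lkerE kerE; apply/subvP => x Wx.
  by rewrite mem_perp_line herm_eq0C Wu.
apply/esym/eqP; rewrite eqn_leq; apply/andP; split.
  by apply: leq_trans (dimvS (subvf _)) _; rewrite dimvf dim_matrix.
rewrite lt0n dimv_eq0 -lkerE kerE; apply/negP => /subvP sWu.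
by apply: nWu => x /sWu; rewrite mem_perp_line herm_eq0C => /eqP.
Qed.

(** Both inequalities of [dim_perp] come from this one: U = 0 bounds the
    dimension of the dual from below, and a complement of U bounds it from
    above, since the dual of the full space is 0. *)
Lemma dim_perp_span_leq U (X : seq 'rV[F]_n) :
  (\dim (perp U) <= \dim (perp (U + <<X>>)) + size X)%N.
Proof.
elim: X U => [|x X IH] U; first by rewrite span_nil addv0 addn0.
rewrite span_cons addvA /= addnS -addSn.
apply: leq_trans (_ : _ <= \dim (perp (U + <[x]>)) + 1)%N _.
  by rewrite -(dim_cap_perp_line (perp U) x) -perpD leq_add2l leq_b1.
by rewrite addn1 addSn ltnS IH.
Qed.

Lemma dim_perp C : (\dim (perp C) + \dim C = n)%N.
Proof.
have dimV : (\dim {:'rV[F]_n} = n)%N by rewrite dimvf /dim /= mul1n.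
apply/eqP; rewrite eqn_leq; apply/andP; split.
  have := dim_perp_span_leq C (vbasis C^C).
  rewrite (span_basis (vbasisP _)) addv_complf perpf dimv0 size_tuple.
  rewrite dimv_compl dimV.
  have := dimvS (subvf C); rewrite dimV; lia.
have := dim_perp_span_leq 0%VS (vbasis C).
by rewrite (span_basis (vbasisP _)) add0v perp0 size_tuple dimV.
Qed.

Lemma perpK C : perp (perp C) = C.
Proof.
apply/eqP; rewrite eq_sym eqEdim; apply/andP; split.
  apply/subvP => x Cx; apply/perpP => y Cy.
  by rewrite hermC (perpE Cx Cy) conj0.
by have := dim_perp C; have := dim_perp (perp C); lia.
Qed.

Lemma rad_perp C : rad (perp C) = rad C.
Proof. by rewrite /hhull perpK capvC. Qed.

Lemma mem_rad C x : (x \in rad C) = (x \in C) && (x \in perp C).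
Proof. exact: memv_cap. Qed.

Lemma dim_rad_leq C :
  (\dim (rad C) <= \dim C)%N /\ (\dim (rad C) <= n - \dim C)%N.
Proof.
split; first exact: dimvS (capvSl _ _).
by have := dimvS (capvSr C (perp C)); have := dim_perp C; rewrite /hhull; lia.
Qed.

(** * Norms and traces from F to its subfield of order q *)

Lemma card_roots_leq (p : {poly F}) (S : {set F}) :
  p != 0 -> {in S, forall t, root p t} -> (#|S| < size p)%N.
Proof.
move=> p0 Sp; rewrite cardE; apply: max_poly_roots => //; last exact: enum_uniq.
by apply/allP => t; rewrite mem_enum => /Sp.
Qed.

Lemma normE_fix (t : F) : (t ^+ q.+1) ^+ q = t ^+ q.+1.
Proof. by rewrite exprS exprMn conjK mulrC. Qed.

Definition norm_fibre (a : F) : {set F} := [set t | t ^+ q.+1 == a].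

Lemma card_norm_fibre_leq a : (#|norm_fibre a| <= q.+1)%N.
Proof.
have sz : size ('X^(q.+1) - a%:P : {poly F}) = q.+2 by rewrite size_XnsubC.
rewrite -ltnS -sz; apply: card_roots_leq => [|t].
  by rewrite -size_poly_eq0 sz.
by rewrite inE rootE !hornerE subr_eq0.
Qed.

(** The Q - 1 nonzero elements are distributed among the fibres over the at
    most q - 1 nonzero fixed points of the conjugation; as a fibre has at most
    q + 1 elements and (q - 1)(q + 1) = Q - 1, each of them is full. *)
Lemma card_norm_fibre a : a != 0 -> a ^+ q = a -> #|norm_fibre a| = q.+1.
Proof.
move=> a0 qa; pose B := [set b : F | (b != 0) && (b ^+ q == b)].
have Ba : a \in B by rewrite inE a0 qa eqxx.
have leB : (#|B| <= q.-1)%N.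
  have sz : size ('X^(q.-1) - 1%:P : {poly F}) = q.-1.+1.
    by rewrite size_XnsubC // -subn1 subn_gt0 q_gt1.
  rewrite -ltnS -sz; apply: card_roots_leq => [|t].
    by rewrite -size_poly_eq0 sz.
  rewrite inE rootE !hornerE subr_eq0 => /andP[t0 /eqP qt].
  by rewrite -(inj_eq (mulfI t0)) -exprS prednK ?q_gt0 // qt mulr1.
have sumB : (\sum_(b in B) #|norm_fibre b| = q ^ 2 - 1)%N.
  transitivity #|[set t : F | t != 0]|.
    rewrite -[RHS]sum1_card.
    rewrite [RHS](partition_big (fun t => t ^+ q.+1) (fun b => b \in B)) /= => [|t].
      apply: eq_bigr => b; rewrite inE => /andP[b0 _]; rewrite -sum1_card.
      apply: eq_bigl => t; rewrite !inE.
      have [Eb|_] := eqVneq (t ^+ q.+1) b; last by rewrite andbF.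
      rewrite andbT; apply/esym; apply: contraNneq b0 => t0.
      by rewrite -Eb t0 expr0n.
    by rewrite !inE => t0; rewrite expf_neq0 //= normE_fix.
  have := cardC1 (0 : F); rewrite cardF subn1 => <-.
  by apply: eq_card => t; rewrite !inE.
apply/eqP; rewrite eqn_leq card_norm_fibre_leq /= leqNgt; apply/negP => lt_a.
have : (\sum_(b in B) #|norm_fibre b| < \sum_(b in B) q.+1)%N.
  rewrite (bigD1 a Ba) [ltnRHS](bigD1 a Ba) /= -addSn leq_add //.
  by apply: leq_sum => b _; exact: card_norm_fibre_leq.
rewrite sumB sum_nat_const ltnNge => /negP; apply.
apply: leq_trans (leq_mul leB (leqnn _)) _.
by have := q_gt0; case: (q) => // m _; nia.
Qed.

(** A form that vanishes on the diagonal would have all its values in the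
    kernel of the trace, which the polynomial X^q + X shows to be proper. *)
Lemma exists_trace_neq0 : exists t : F, t + t ^+ q != 0.
Proof.
apply/existsP; rewrite -negb_forall; apply/negP => /forallP tr0.
have sz : size ('X^q + 'X : {poly F}) = q.+1.
  by rewrite size_polyDl size_polyXn ?size_polyX // ltnS q_gt1.
have : (#|[set: F]| < q.+1)%N.
  rewrite -sz; apply: card_roots_leq => [|t _].
    by rewrite -size_poly_eq0 sz.
  by rewrite rootE !hornerE addrC.
by rewrite cardsT cardF ltnS -mulnn leqNgt ltn_Pmulr ?q_gt0 ?q_gt1.
Qed.

Definition aniso W : {set 'rV[F]_n} := [set u in W | '[u, u] != 0].

(** Polarization: if x and y are not orthogonal, then '[x, y] can be rescaled
    to any s, and for isotropic x and y the value at x + y is the trace of s. *)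
Lemma exists_aniso W : (\dim (rad W) < \dim W)%N -> exists u, u \in aniso W.
Proof.
move=> ltW; apply/set0Pn; apply/eqP => no_aniso.
have iso u : u \in W -> '[u, u] = 0.
  move=> Wu; apply/eqP; apply: contraFT (in_set0 u) => nz.
  by rewrite -no_aniso inE Wu.
have [s ntr] := exists_trace_neq0.
have: (W <= rad W)%VS.
  apply/subvP => y Wy; rewrite mem_rad Wy; apply/perpP => x Wx.
  apply/eqP; apply: contraNT ntr => xy0.
  have := iso _ (memvD (memvZ (s / '[x, y]) Wx) Wy).
  rewrite hermDl !hermDr !hermZl !hermZr (iso x) // (iso y) // (hermC x y).
  by rewrite !mulr0 add0r addr0 exprMn exprVn divfK // divfK ?expf_neq0 // => ->.
by move/dimvS; rewrite leqNgt ltW.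
Qed.

(** * Hyperplanes cut out by a vector *)

Lemma perp_le_line C u : (C <= perp <[u]>)%VS = (u \in perp C).
Proof.
apply/subvP/perpP => [sCu x /sCu | Cu x Cx].
  by rewrite mem_perp_line herm_eq0C => /eqP.
by rewrite mem_perp_line herm_eq0C Cu.
Qed.

(** With [addv_cap_perp], this is the bijection that both double counts use:
    E determines C, and v determines the way back from C to E. *)
Lemma cap_perp_addv E u v : v \in E -> '[u, v] != 0 ->
  (E :&: perp <[u]> + <[v]>)%VS = E.
Proof.
move=> Ev uv; have vu : '[v, u] != 0 by rewrite herm_eq0C.
apply/eqP; rewrite eqEsubv; apply/andP; split.
  by rewrite subv_add capvSl; apply/subvP => x /vlineP[t ->]; rewrite memvZ.
apply/subvP => x Ex; rewrite -(subrK (('[x, u] / '[v, u]) *: v) x).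
rewrite memv_add ?memvZ ?memv_line // memv_cap memvB ?memvZ //=.
by rewrite mem_perp_line herm_eq0C hermDl hermNl hermZl divfK // subrr.
Qed.

Lemma addv_cap_perp C u v : u \in perp C -> '[u, v] != 0 ->
  ((C + <[v]>) :&: perp <[u]>)%VS = C.
Proof.
move=> Cu uv; apply/eqP; rewrite eqEsubv subv_cap addvSl perp_le_line Cu !andbT.
apply/subvP => x /memv_capP[/memv_addP[y Cy [_ /vlineP[t ->] ->]]].
rewrite mem_perp_line hermDr hermZr hermC (perpE Cy Cu) conj0 add0r mulf_eq0.
rewrite (negPf uv) orbF expf_eq0 => /andP[_ /eqP->].
by rewrite scale0r addr0.
Qed.

Lemma dim_addv_line C u v : u \in perp C -> '[u, v] != 0 ->
  \dim (C + <[v]>) = (\dim C).+1.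
Proof.
move=> Cu uv; rewrite -(dim_cap_perp_line (C + <[v]>) u) addv_cap_perp //.
suff -> : u \notin perp (C + <[v]>) by rewrite addn1.
apply: contraNN uv => /perpP/(_ v) uv0.
by rewrite herm_eq0C uv0 // (subvP (addvSr _ _)) ?memv_line.
Qed.

Lemma rad_addv_aniso C u : u \in perp C -> '[u, u] != 0 ->
  rad (C + <[u]>) = rad C.
Proof.
move=> Cu uu; rewrite /hhull perpD [(perp C :&: _)%VS]capvC capvA.
by rewrite addv_cap_perp.
Qed.

(** The dual of the hyperplane is perp E + <[u]>, and u lies in the hyperplane,
    so the modular law moves <[u]> out of the intersection. *)
Lemma rad_cap_iso E u : u \in E -> '[u, u] = 0 ->
  rad (E :&: perp <[u]>) = (rad E + <[u]>)%VS.
Proof.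
move=> Eu uu.
have sEu : (perp E <= perp <[u]>)%VS by rewrite perp_le_line perpK.
have sub_u : (<[u]> <= E :&: perp <[u]>)%VS.
  apply/subvP => x /vlineP[t ->].
  by rewrite memvZ // memv_cap Eu mem_perp_line uu /=.
have -> : rad E = (E :&: perp <[u]> :&: perp E)%VS.
  by rewrite -capvA (capv_idPr sEu).
rewrite (vspace_modr _ sub_u) /hhull; congr (_ :&: _)%VS.
by rewrite -[RHS]perpK perpD perpK.
Qed.

Lemma dim_rad_cap_iso E u v : u \in E -> v \in E -> '[u, u] = 0 ->
  '[u, v] != 0 -> \dim (rad (E :&: perp <[u]>)) = (\dim (rad E)).+1.
Proof.
move=> Eu Ev uu uv; rewrite rad_cap_iso // dimv_disjoint_sum.
  rewrite dim_vline; case: (eqVneq u 0) uv => [->|_ _]; last by rewrite addn1.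
  by rewrite herm0l eqxx.
apply/vspaceP => x; rewrite memv_cap memv0 mem_rad.
apply/idP/eqP => [/andP[/andP[_ Ex] /vlineP[t Dx]] | ->]; last by rewrite !mem0v.
have /eqP := perpE Ev Ex; rewrite Dx hermZr mulf_eq0 expf_eq0 q_gt0 /=.
by rewrite -herm_eq0C (negPf uv) orbF => /eqP->; rewrite scale0r.
Qed.

(** * Two double counts *)

Definition hcode (k l : nat) C := (\dim C == k) && (\dim (rad C) == l).

Lemma hcode_addv_aniso k l C u : u \in perp C -> '[u, u] != 0 ->
  hcode k.+1 l (C + <[u]>) = hcode k l C.
Proof. by move=> Cu uu; rewrite /hcode (dim_addv_line Cu uu) rad_addv_aniso. Qed.

(** Splitting off an anisotropic vector preserves the hull, so the hyperplane
    of E orthogonal to u has hull dimension l again. *)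
Lemma sum_aniso (k l : nat) :
  (\sum_(E | hcode k.+1 l E) #|aniso E|
   = \sum_(C | hcode k l C) #|aniso (perp C)|)%N.
Proof.
under eq_bigr do rewrite -sum1_card.
under [RHS]eq_bigr do rewrite -sum1_card.
rewrite !pair_big_dep /=.
rewrite (reindex_onto
    (fun p : {vspace 'rV[F]_n} * 'rV[F]_n => ((p.1 + <[p.2]>)%VS, p.2))
    (fun p : {vspace 'rV[F]_n} * 'rV[F]_n =>
       ((p.1 :&: perp <[p.2]>)%VS, p.2))) /=.
  apply: eq_bigl => -[C u] /=; rewrite xpair_eqE eqxx andbT !inE.
  have [_|uu] := eqVneq '[u, u] 0; first by rewrite !andbF.
  rewrite !andbT (subvP (addvSr _ _)) ?memv_line // andbT.
  have [Cu|nCu] := boolP (u \in perp C).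
    by rewrite hcode_addv_aniso // addv_cap_perp // eqxx.
  rewrite andbF; apply: contraNF nCu => /andP[_ /eqP <-].
  by rewrite -perp_le_line capvSr.
by move=> [E u] /=; rewrite inE => /andP[_ /andP[Eu uu]]; rewrite cap_perp_addv.
Qed.

(** The vector v is recorded besides u so that E can be recovered from its
    hyperplane; all pairs with a fixed u have the same number of v. *)
Definition oblique (S : {set 'rV[F]_n}) W : {set 'rV[F]_n * 'rV[F]_n} :=
  [set p | [&& p.1 \in S, p.2 \in W & '[p.1, p.2] != 0]].

Definition iso E : {set 'rV[F]_n} := [set u in E | '[u, u] == 0].

(** Here the hyperplane orthogonal to u contains u in its hull, which grows by
    one dimension.  The existence of v forces u to be outside the hull of E, and
    to be nonzero in the hull of C. *)
Lemma sum_oblique (k l : nat) :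
  (\sum_(E | hcode k.+1 l E) #|oblique (iso E) E|
   = \sum_(C | hcode k l.+1 C) #|oblique [set u in rad C] fullv|)%N.
Proof.
under eq_bigr do rewrite -sum1_card.
under [RHS]eq_bigr do rewrite -sum1_card.
rewrite !pair_big_dep /=.
rewrite (reindex_onto
    (fun p : {vspace 'rV[F]_n} * ('rV[F]_n * 'rV[F]_n) =>
       ((p.1 + <[p.2.2]>)%VS, p.2))
    (fun p : {vspace 'rV[F]_n} * ('rV[F]_n * 'rV[F]_n) =>
       ((p.1 :&: perp <[p.2.1]>)%VS, p.2))) /=.
  apply: eq_bigl => -[C [u v]] /=; rewrite xpair_eqE eqxx andbT !inE /= memvf.
  have [_|uv] := eqVneq '[u, v] 0; first by rewrite !andbF.
  have vE : v \in (C + <[v]>)%VS by rewrite (subvP (addvSr _ _)) ?memv_line.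
  rewrite vE !andbT.
  have [Cu|nCu] := boolP (u \in rad C); last first.
    rewrite andbF; apply: contraNF nCu => /andP[/andP[_ /andP[CVu uu]] /eqP defC].
    have uC: u \in C by rewrite -defC memv_cap CVu mem_perp_line.
    by rewrite mem_rad uC -perp_le_line -defC capvSr.
  have := Cu; rewrite mem_rad => /andP[uC Cu'].
  have uE : u \in (C + <[v]>)%VS by rewrite (subvP (addvSl _ _)).
  have uu := perpE uC Cu'.
  rewrite uE uu eqxx addv_cap_perp // eqxx !andbT /hcode (dim_addv_line Cu' uv).
  by have := dim_rad_cap_iso uE vE uu uv; rewrite addv_cap_perp // => ->.
move=> [E [u v]] /=; rewrite !inE /= => /andP[_ /and3P[_ Ev uv]].
by rewrite cap_perp_addv.
Qed.

(** * Counting the fibres *)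

Lemma card_oblique_fibre W u : u \notin perp W ->
  (q ^ 2 * #|[set v in W | '[u, v] != 0%R]| = (q ^ 2 - 1) * #|W|)%N.
Proof.
move=> nWu.
have splitW : (#|W| = #|[set v in W | '[u, v] != 0%R]|
                      + #|(W :&: perp <[u]>)%VS|)%N.
  rewrite -(cardID [pred v | '[u, v] == 0%R] W) addnC.
  congr (_ + _)%N; apply: eq_card => v.
    by rewrite !inE andbC.
  by rewrite !inE memv_cap mem_perp_line.
have := dim_cap_perp_line W u; rewrite nWu addn1 => dimW.
move: splitW; rewrite !card_vspace -dimW cardF expnS => eqW.
by rewrite mulnCA mulnBl mul1n eqW addnK.
Qed.

Lemma card_oblique (S : {set 'rV[F]_n}) W :
  (q ^ 2 * #|oblique S W|
   = #|S :\: [set u in perp W]| * ((q ^ 2 - 1) * #|W|))%N.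
Proof.
rewrite -sum1_card.
rewrite (eq_bigl (fun p => (p.1 \in S)
    && (p.2 \in [set v in W | '[p.1, v] != 0]))); last first.
  by move=> p; rewrite !inE.
rewrite -(pair_big_dep _ (fun u v => v \in [set v in W | '[u, v] != 0])
  (fun _ _ => 1%N)) /=.
under eq_bigr do rewrite sum1_card.
rewrite big_distrr /= (bigID (fun u => u \in perp W)) /=.
rewrite big1 ?add0n => [|u /andP[_ /perpP Wu]].
  rewrite -sum_nat_const; apply: eq_big => [u | u /andP[_]].
    by rewrite !inE andbC.
  exact: card_oblique_fibre.
apply/eqP; rewrite muln_eq0 cards_eq0; apply/orP; right; apply/eqP/setP => v.
by rewrite !inE herm_eq0C; apply/negP => /andP[/Wu ->]; rewrite eqxx.
Qed.

Lemma card_aniso_fibre a s : a != 0 -> a ^+ q = a -> s ^+ q = s ->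
  (#|[set t : F | t ^+ q.+1 * a + s != 0%R]%R|
   + (if s == 0%R then 1 else q.+1) = q ^ 2)%N.
Proof.
move=> a0 qa qs; rewrite -cardF -cardsT.
rewrite -(cardsID (norm_fibre (- s / a)) setT) [RHS]addnC; congr (_ + _)%N.
  apply: eq_card => t; rewrite !inE andbT mulNr -addr_eq0.
  rewrite -[in RHS](mulIr_eq0 _ (mulIf a0)).
  by rewrite mulrDl divfK.
rewrite setTI; have [->|s0] := eqVneq s 0.
  rewrite -(cards1 (0 : F)); apply: eq_card => t.
  by rewrite !inE oppr0 mul0r expf_eq0.
rewrite card_norm_fibre //; first by rewrite mulf_neq0 ?oppr_eq0 ?invr_eq0.
by rewrite exprMn exprVn conjN qa qs.
Qed.

(** Write the vectors of W as t u + x with x in W'.  For isotropic x every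
    nonzero t gives an anisotropic vector, and for anisotropic x all but the
    q + 1 scalars t of a prescribed norm do. *)
Lemma card_aniso_rec W u : u \in aniso W ->
  let W' := (W :&: perp <[u]>)%VS in
  (#|aniso W| + #|W'| + q * #|aniso W'| = q ^ 2 * #|W'|)%N.
Proof.
rewrite inE => /andP[Wu uu] W'.
have W'u x : x \in W' -> '[x, u] = 0.
  by rewrite memv_cap mem_perp_line herm_eq0C => /andP[_ /eqP].
have -> : #|aniso W| = (\sum_(x in W')
    #|[set t : F | t ^+ q.+1 * '[u, u] + '[x, x] != 0%R]%R|)%N.
  under eq_bigr do rewrite -sum1_card.
  rewrite pair_big_dep /= -sum1_card.
  rewrite (reindex_onto (fun p => p.2 *: u + p.1)
             (fun w => (w - ('[w, u] / '[u, u]) *: u, '[w, u] / '[u, u]))) /=.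
    apply: eq_bigl => -[x t] /=; rewrite !inE xpair_eqE.
    have [W'x|nW'x] := boolP (x \in W').
      have -> : '[t *: u + x, u] / '[u, u] = t.
        by rewrite hermDl hermZl (W'u x) // addr0 mulfK.
      rewrite [X in X - _]addrC addrK !eqxx !andbT /=.
      have /memv_capP[Wx _] := W'x.
      rewrite memvD ?memvZ //= !hermDl !hermDr !hermZl !hermZr.
      rewrite (W'u x) // (hermC x u) (W'u x) //.
      by rewrite conj0 !mulr0 addr0 add0r mulrA -exprS.
    apply: contraNF nW'x => /andP[/andP[Ww _] /andP[/eqP Dx /eqP Dt]].
    have Wx : x \in W by rewrite -Dx memvB // memvZ.
    rewrite memv_cap Wx mem_perp_line herm_eq0C -{1}Dx.
    by rewrite hermDl hermNl hermZl divfK // subrr eqxx.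
  by move=> w _; rewrite addrC subrK.
have -> : (q * #|aniso W'| = \sum_(x in W') (if '[x, x] != 0%R then q else 0))%N.
  rewrite -big_mkcondr mulnC -sum_nat_const /=.
  by apply: eq_bigl => x; rewrite inE.
rewrite -[in LHS]sum1_card -!big_split /= mulnC -sum_nat_const.
apply: eq_bigr => x _.
rewrite -(card_aniso_fibre uu (herm_norm_fix u) (herm_norm_fix x)).
by rewrite -addnA; case: eqP.
Qed.

(** The factor q on the left keeps the formula uniform: for b = 0 both sides
    vanish, while the cardinality itself would involve q ^ (b - 1). *)
Lemma card_aniso (b : nat) W : (\dim W = \dim (rad W) + b)%N ->
  q%:R * #|aniso W|%:R
    = q%:R ^+ 2 ^+ \dim (rad W) * q%:R ^+ b
      * (q%:R ^+ b - (-1) ^+ b) * (q%:R - 1) :> rat.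
Proof.
elim: b W => [|b IH] W dimW.
  have -> : aniso W = set0.
    apply/setP => u; rewrite !inE; apply/negP => /andP[Wu].
    have /eqP eqW : rad W == W by rewrite eqEdim capvSl dimW addn0 /=.
    have : u \in rad W by rewrite eqW.
    by rewrite mem_rad => /andP[_ /(perpE Wu) ->]; rewrite eqxx.
  by rewrite cards0 !expr0 subrr !mulr0 mul0r.
have [u Wu]: exists u, u \in aniso W by apply: exists_aniso; lia.
have /= := card_aniso_rec Wu; set W' := (W :&: _)%VS.
have := Wu; rewrite inE => /andP[uW uu].
have uW' : u \in perp W' by rewrite -perp_le_line capvSr.
have defW : W = (W' + <[u]>)%VS by rewrite cap_perp_addv.
have radW : rad W = rad W' by rewrite {1}defW rad_addv_aniso.
have dimW' : (\dim W' = \dim (rad W') + b)%N.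
  have := dim_addv_line uW' uu; rewrite -defW; rewrite -radW; lia.
move/(congr1 (fun m : nat => m%:R : rat)); rewrite card_vspace cardF dimW' radW.
have := IH _ dimW'.
rewrite !(natrD, natrM, natrX) exprD (exprAC _ 2 b) => ->.
move=> /(canRL (addrK _))/(canRL (addrK _)) ->.
rewrite !(exprS _ b).
move: (q%:R ^+ b : rat) ((-1) ^+ b : rat) (q%:R ^+ 2 ^+ \dim (rad W') : rat).
by move: (q%:R : rat) => p Y e R; ring.
Qed.

(** * The recurrence in the hull dimension *)

Definition hull_count (k l : nat) : rat := (num_codes F q n k l)%:R.

Lemma sum_hcode (k l : nat) (c : rat) :
  \sum_(C | hcode k l C) c = hull_count k l * c.
Proof. by rewrite sumr_const -mulr_natl /hull_count /num_codes cardsE. Qed.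

Lemma hull_count_aniso (l a b : nat) : (2 * l + a + b = n)%N ->
  hull_count (l + a) l * (q%:R ^+ b * (q%:R ^+ b - (-1) ^+ b))
  = hull_count (l + a).+1 l * (q%:R ^+ a.+1 * (q%:R ^+ a.+1 - (-1) ^+ a.+1)).
Proof.
move=> Dn; have q0 : q%:R != 0 :> rat by rewrite pnatr_eq0 -lt0n q_gt0.
have q1 : q%:R - 1 != 0 :> rat by rewrite subr_eq0 (eqr_nat _ q 1) gtn_eqF ?q_gt1.
have := sum_aniso (l + a) l.
move/(congr1 (fun m : nat => q%:R * m%:R : rat)); rewrite !natr_sum !mulr_sumr.
rewrite (eq_bigr (fun=> q%:R ^+ 2 ^+ l * q%:R ^+ a.+1
    * (q%:R ^+ a.+1 - (-1) ^+ a.+1) * (q%:R - 1))); last first.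
  by move=> E /andP[/eqP dimE /eqP radE]; rewrite (@card_aniso a.+1) radE //
    dimE addnS.
rewrite [RHS](eq_bigr (fun=> q%:R ^+ 2 ^+ l * q%:R ^+ b
    * (q%:R ^+ b - (-1) ^+ b) * (q%:R - 1))); last first.
  move=> C /andP[/eqP dimC /eqP radC]; rewrite (@card_aniso b) rad_perp radC //.
  by have := dim_perp C; lia.
rewrite !sum_hcode.
have R0 : q%:R ^+ 2 ^+ l != 0 :> rat by rewrite !expf_neq0.
move: (q%:R ^+ 2 ^+ l : rat) (q%:R ^+ a.+1 : rat) (q%:R ^+ b : rat) R0.
move=> R Y Z R0 eqA.
apply: (mulIf (mulf_neq0 R0 q1)).
transitivity (hull_count (l + a) l * (R * Z * (Z - (-1) ^+ b) * (q%:R - 1))).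
  by ring.
by rewrite -eqA; ring.
Qed.

Lemma card_iso_notin_perp E :
  (#|iso E :\: [set u in perp E]| + #|aniso E| + #|rad E| = #|E|)%N.
Proof.
rewrite -[#|E|]cardsE -(cardsID [set u | '[u, u] == 0] [set u in E]).
have -> : [set u in E] :&: [set u | '[u, u] == 0] = iso E.
  by apply/setP => u; rewrite !inE.
have -> : [set u in E] :\: [set u | '[u, u] == 0] = aniso E.
  by apply/setP => u; rewrite !inE andbC.
rewrite addnAC; congr (_ + _)%N.
rewrite -(cardsID [set u in perp E] (iso E)) addnC; congr (_ + _)%N.
  rewrite -cardsE; apply: eq_card => u; rewrite !inE mem_rad.
  have [Eu|] := boolP (u \in E) => //=.
  by have [/(perpE Eu) ->|] := boolP (u \in perp E); rewrite ?eqxx ?andbF.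
Qed.

(** By [card_aniso], the number of isotropic vectors of E outside its hull
    factors as Q ^ l (q ^ (a + 1) + e(a)) (q ^ a - e(a)). *)
Lemma hull_count_iso (l a b : nat) : (2 * l + a + b.+1 = n)%N ->
  hull_count (l + a).+1 l
    * ((q%:R ^+ a.+1 + (-1) ^+ a) * (q%:R ^+ a - (-1) ^+ a))
  = hull_count (l + a) l.+1 * ((q%:R ^+ 2 ^+ l.+1 - 1) * q%:R ^+ 2 ^+ b).
Proof.
move=> Dn; have q0 : q%:R != 0 :> rat by rewrite pnatr_eq0 -lt0n q_gt0.
have q2_gt1 : (1 < q ^ 2)%N by rewrite -mulnn; have := q_gt1; nia.
have Q1 : q%:R ^+ 2 - 1 != 0 :> rat.
  by rewrite subr_eq0 -natrX (eqr_nat _ _ 1) gtn_eqF.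
have cardE E : hcode (l + a).+1 l E -> (q ^ 2 * #|oblique (iso E) E|)%:R
    = q%:R ^+ 2 ^+ l * (q%:R ^+ a.+1 + (-1) ^+ a) * (q%:R ^+ a - (-1) ^+ a)
      * ((q%:R ^+ 2 - 1) * q%:R ^+ 2 ^+ (l + a).+1) :> rat.
  move=> /andP[/eqP dimE /eqP radE]; rewrite card_oblique.
  rewrite !natrM natrB ?(ltnW q2_gt1) // card_vspace cardF dimE !natrX.
  congr (_ * _).
  have := card_iso_notin_perp E.
  move/(congr1 (fun m : nat => q%:R * m%:R : rat)); rewrite !natrD !mulrDr.
  rewrite (@card_aniso a.+1 E).
    rewrite !card_vspace cardF dimE radE !natrX -addnS exprD (exprAC _ 2 a.+1).
    rewrite !(exprS _ a).
    have : (-1) ^+ a * (-1) ^+ a = 1 :> rat.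
      by rewrite -exprMn mulrNN mulr1 expr1n.
    move: (q%:R ^+ a : rat) ((-1) ^+ a : rat) (q%:R ^+ 2 ^+ l : rat) => Y e R ee.
    move: q0; move: (q%:R : rat) => p p0.
    move=> /(canRL (addrK _))/(canRL (addrK _)) eqN.
    apply: (mulfI p0); rewrite eqN.
    transitivity (p * R * (p * Y * Y - p * Y * e + e * Y - 1)); first by ring.
    by rewrite -ee; ring.
  by rewrite radE dimE addnS.
have cardC C : hcode (l + a) l.+1 C ->
    (q ^ 2 * #|oblique [set u in rad C] fullv|)%:R
    = (q%:R ^+ 2 ^+ l.+1 - 1) * ((q%:R ^+ 2 - 1) * q%:R ^+ 2 ^+ n) :> rat.
  move=> /andP[/eqP dimC /eqP radC]; rewrite card_oblique perpf.
  rewrite !natrM natrB ?(ltnW q2_gt1) // card_vspace cardF dimvf /dim /=.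
  rewrite mul1n !natrX; congr (_ * _).
  have -> : [set u in rad C] :\: [set u in (0%VS : {vspace 'rV[F]_n})]
            = [set u in rad C] :\ 0.
    by apply/setP => u; rewrite !inE memv0.
  have := cardsD1 0 [set u in rad C].
  rewrite inE mem0v cardsE card_vspace cardF radC.
  move/(congr1 (fun m : nat => m%:R : rat)); rewrite natrD !natrX => ->.
  by rewrite addrC addKr.
have := sum_oblique (l + a) l.
move/(congr1 (fun m : nat => (q ^ 2 * m)%N%:R : rat)).
rewrite !big_distrr /= !natr_sum.
rewrite (eq_bigr _ cardE) (eq_bigr _ cardC).
rewrite !sum_hcode.
have -> : n = (l + (l + a).+1 + b)%N by lia.
rewrite !exprD.
have R0 : q%:R ^+ 2 ^+ l != 0 :> rat by rewrite !expf_neq0.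
have S0 : q%:R ^+ 2 ^+ (l + a).+1 != 0 :> rat by rewrite !expf_neq0.
move: Q1 R0 S0.
move: (q%:R ^+ 2 ^+ (l + a).+1 : rat) (q%:R ^+ 2 ^+ l : rat).
move=> S R Q1 R0 S0 eqA.
apply: (mulIf (mulf_neq0 (mulf_neq0 R0 Q1) S0)).
rewrite -[LHS]mulrA; transitivity (hull_count (l + a).+1 l
    * (R * (q%:R ^+ a.+1 + (-1) ^+ a) * (q%:R ^+ a - (-1) ^+ a)
       * ((q%:R ^+ 2 - 1) * S))).
  congr (_ * _); move: (q%:R ^+ a.+1 + _) (q%:R ^+ a - _) (q%:R ^+ 2 - 1).
  by move=> x y z; ring.
rewrite eqA; move: (hull_count _ _) (q%:R ^+ 2 ^+ l.+1 - 1).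
by move: (q%:R ^+ 2 - 1) (q%:R ^+ 2 ^+ b) => z t x y; ring.
Qed.

Lemma hull_count_ratio (l a b : nat) : (2 * l + a.+1 + b.+1 = n)%N ->
  hull_count (l + a.+1) l
    * ((q%:R ^+ a.+1 - (-1) ^+ a.+1) * (q%:R ^+ b.+1 - (-1) ^+ b.+1))
  = hull_count (l + a.+1) l.+1
    * (q%:R ^+ (a + b).+1 * (q%:R ^+ 2 ^+ l.+1 - 1)).
Proof.
move=> Dn; have q0 : q%:R != 0 :> rat by rewrite pnatr_eq0 -lt0n q_gt0.
have := hull_count_aniso Dn; have := hull_count_iso Dn.
have Y0 : q%:R ^+ b != 0 :> rat by rewrite expf_neq0.
have -> : q%:R ^+ a.+2 - (-1) ^+ a.+2 = q%:R ^+ a.+2 + (-1) ^+ a.+1 :> rat.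
  by rewrite [(-1) ^+ a.+2]exprS mulN1r opprK.
rewrite (exprAC _ 2 b); move: (q%:R ^+ 2 ^+ l.+1 - 1 : rat) => L.
rewrite [q%:R ^+ a.+2]exprS -[(a + b).+1]addSn exprD [q%:R ^+ b.+1]exprS -!addnS.
move: Y0 q0; move: (hull_count _ l) (hull_count _ l) (hull_count _ l.+1).
move: ((-1) ^+ a.+1 : rat) ((-1) ^+ b.+1 : rat) => e f.
move: (q%:R : rat) (q%:R ^+ a.+1 : rat) (q%:R ^+ b : rat).
move=> p X Y A2 A1 A3 Y0 p0 eq_iso eq_aniso.
apply: (mulIf (mulf_neq0 p0 Y0)).
transitivity (A2 * (p * Y * (p * Y - f)) * (X - e)); first by ring.
rewrite eq_aniso.
transitivity (A1 * ((p * X + e) * (X - e)) * (p * X)); first by ring.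
by rewrite eq_iso; ring.
Qed.

Lemma hull_count_eq0S k l : (l < k)%N -> (k + l < n)%N ->
  (hull_count k l == 0) = (hull_count k l.+1 == 0).
Proof.
move=> lt_lk lt_kn.
have [a Dk] : exists a, k = (l + a.+1)%N
  by exists (k - l.+1)%N; lia.
have [b Dn] : exists b, (2 * l + a.+1 + b.+1 = n)%N
  by exists (n - k - l.+1)%N; lia.
have Q1 : q%:R ^+ 2 ^+ l.+1 - 1 != 0 :> rat.
  rewrite subr_eq0 -!natrX (eqr_nat _ _ 1) gtn_eqF // -expnM.
  by rewrite -(expn0 q) ltn_exp2l // q_gt1.
have q0 : q%:R != 0 :> rat by rewrite pnatr_eq0 -lt0n q_gt0.
have D0 m : q%:R ^+ m.+1 - (-1) ^+ m.+1 != 0 :> rat.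
  by rewrite lt0r_neq0 ?signed_pow_gt0 ?q_gt1.
rewrite Dk -(mulIr_eq0 _ (mulIf (mulf_neq0 (D0 a) (D0 b)))).
rewrite hull_count_ratio // mulf_eq0.
by rewrite (negPf (mulf_neq0 (expf_neq0 _ q0) Q1)) orbF.
Qed.

Lemma exists_dim k : (k <= n)%N -> exists C, \dim C = k.
Proof.
move=> le_kn; pose B := vbasis {:'rV[F]_n}.
exists <<take k B>>%VS; have : free (take k B).
  apply: (@catl_free _ _ (drop k B)).
  by rewrite cat_take_drop (basis_free (vbasisP _)).
by move/eqP ->; rewrite size_takel // size_tuple dimvf /dim /= mul1n.
Qed.

(** The recurrence propagates vanishing in both directions, so the hull
    dimension of an arbitrary code of dimension k is enough to start from. *)
Lemma hull_count_gt0 k l : (l <= k)%N -> (k + l <= n)%N -> 0 < hull_count k l.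
Proof.
move=> le_lk le_kln; have [|C dimC] := @exists_dim k; first lia.
have const m : (m <= k)%N -> (k + m <= n)%N ->
    (hull_count k m == 0) = (hull_count k 0 == 0).
  elim: m => // m IH lt_mk lt_kmn.
  by rewrite -hull_count_eq0S ?IH //; lia.
have [rad_k rad_n] := dim_rad_leq C.
rewrite lt0r ler0n andbT const // -(const (\dim (rad C))); try lia.
by rewrite pnatr_eq0 -lt0n; apply/card_gt0P; exists C; rewrite inE dimC !eqxx.
Qed.

End HermitianGeometry.

(** * Strict monotonicity *)

(** Both factors are at most q ^ m + 1, hence at most q ^ m (q + 1) / q, and
    this crude bound suffices unless q = 2 and l = 0.  In that case only two
    odd exponents are critical: with X = 2 ^ a and Y = 2 ^ b the claim reads
    2 (X + 1)(Y + 1) < 3 X Y, which holds for X, Y >= 8 and fails if X or Y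
    is 2. *)
Lemma signed_pow_bound (q l a b : nat) : (1 < q)%N -> (0 < a)%N -> (0 < b)%N ->
  ~ [/\ q = 2%N, l = 0%N, ~~ odd (a + b) & (a == 1%N) || (b == 1%N)] ->
  (q%:R ^+ a - (-1) ^+ a) * (q%:R ^+ b - (-1) ^+ b) * q%:R
    < q%:R ^+ a * q%:R ^+ b * (q%:R ^+ 2 ^+ l.+1 - 1) :> rat.
Proof.
move=> q_gt1 a_gt0 b_gt0 not_exc.
have q2 : 2 <= q%:R :> rat by rewrite (ler_nat _ 2 q).
have pow_ge m : (0 < m)%N -> q%:R <= q%:R ^+ m :> rat.
  by move=> m0; apply: ler_eXnr; rewrite // (ler_nat _ 1 q) ltnW.
have sgn m : (- 1 <= ((-1) ^+ m : rat) <= 1) by rewrite -signr_odd; case: odd.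
have [small|big] := boolP ((q == 2) && (l == 0)); last first.
  (* The case other than q = 2, l = 0, after cancelling the powers q ^ a and
     q ^ b. *)
  have L3 : (q%:R + 1) ^+ 2 < q%:R * (q%:R ^+ 2 ^+ l.+1 - 1) :> rat.
    move: big; rewrite negb_and => /orP[q_neq2|l_neq0].
      have q3 : 3 <= q%:R :> rat.
        by rewrite (ler_nat _ 3 q) ltn_neqAle eq_sym q_neq2.
      have : 1 <= q%:R ^+ 2 ^+ l :> rat.
        by rewrite !exprn_ege1 // (ler_nat _ 1 q) ltnW.
      rewrite [_ ^+ l.+1]exprS; move: (q%:R ^+ 2 ^+ l : rat) => L L1.
      move: (q%:R : rat) q3 => p q3.
      have pL : p ^+ 2 <= p ^+ 2 * L by nra.
      have : p * (p ^+ 2 - 1) <= p * (p ^+ 2 * L - 1) by nra.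
      by move=> le_pL; apply: lt_le_trans le_pL; nra.
    have L4 : 4 <= q%:R ^+ 2 ^+ l :> rat.
      have p4 : 4 <= q%:R ^+ 2 :> rat by nra.
      by apply: (le_trans p4); apply: ler_eXnr; rewrite ?lt0n //; lra.
    rewrite [_ ^+ l.+1]exprS; move: L4 q2; move: (q%:R ^+ 2 ^+ l : rat) => L.
    move: (q%:R : rat) => p L4 q2.
    have pL : p ^+ 2 * 4 <= p ^+ 2 * L by nra.
    have : p * (p ^+ 2 * 4 - 1) <= p * (p ^+ 2 * L - 1) by nra.
    by move=> le_pL; apply: lt_le_trans le_pL; nra.
  have := pow_ge _ a_gt0; have := pow_ge _ b_gt0; have := sgn a; have := sgn b.
  move: L3 q2.
  move: (q%:R ^+ 2 ^+ l.+1 - 1 : rat) (q%:R ^+ a : rat) (q%:R ^+ b : rat).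
  move=> L X Y; move: (q%:R : rat) ((-1) ^+ a : rat) ((-1) ^+ b : rat) => p e f.
  move=> L3 p2 /andP[f1 f2] /andP[e1 e2] Yp Xp.
  have p0 : 0 < p by lra.
  have leX : (X - e) * p <= X * (p + 1) by nra.
  have leY : (Y - f) * p <= Y * (p + 1) by nra.
  rewrite -(ltr_pM2r p0); apply: (@le_lt_trans _ _ (X * (p + 1) * (Y * (p + 1)))).
    have -> : (X - e) * (Y - f) * p * p = (X - e) * p * ((Y - f) * p) by ring.
    by apply: ler_pM => //; apply: mulr_ge0; lra.
  have XY : 0 < X * Y by apply: mulr_gt0; lra.
  have -> : X * (p + 1) * (Y * (p + 1)) = X * Y * (p + 1) ^+ 2 by ring.
  have -> : X * Y * L * p = X * Y * (p * L) by ring.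
  by rewrite (ltr_pM2l XY).
have /andP[/eqP Dq /eqP Dl] := small; rewrite Dq Dl in q2 pow_ge not_exc *.
have Xa := pow_ge _ a_gt0; have Yb := pow_ge _ b_gt0.
rewrite expr1 -[(-1) ^+ a]signr_odd -[(-1) ^+ b]signr_odd.
(* An odd exponent other than 1 is at least 3. *)
have big_pow m : odd m -> m != 1%N -> 8 <= 2 ^+ m :> rat.
  case: m => [|[|[|m]]] //= _ _; rewrite !exprS.
  have m1 : 1 <= 2 ^+ m :> rat by exact: exprn_ege1.
  lra.
have odd_case : odd a -> odd b -> 8 <= 2 ^+ a :> rat /\ 8 <= 2 ^+ b :> rat.
  move=> oa ob; have exc : ~~ ((a == 1%N) || (b == 1%N)).
    by apply/negP => ab; apply: not_exc; rewrite oddD oa ob.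
  by move: exc; rewrite negb_or => /andP[/big_pow-> // /big_pow->].
move: odd_case Xa Yb; move: (2%:R ^+ a : rat) (2%:R ^+ b : rat) => X Y.
have -> : 2 ^+ 2 - 1 = 3 :> rat by [].
(case: (odd a); case: (odd b)) => /= [/(_ isT isT)[X8 Y8]|_|_|_] X2 Y2;
  rewrite ?expr0 ?expr1; nra.
Qed.

Theorem corollary20 (q : nat) (F : finFieldType) (n k l : nat) (c : int) :
  prime_power q -> #|F| = (q ^ 2)%N ->
  (0 < n)%N -> (0 < k)%N ->
  (l + 1 <= k)%N -> (k <= n - l - 1)%N ->
  c = n%:Z - k%:Z - l%:Z ->
  ((num_codes F q n k l)%:R : rat)
    = alphaH n k l q * (q%:R ^+ (l + 1) - 1)
      * (num_codes F q n k (l + 1))%:R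
  /\ (~ (l = 0%N /\ ~~ odd n /\
         (q, k) \in [:: (2%N, 1%N); (2%N, (n - 1)%N)]) ->
      (num_codes F q n k (l + 1) < num_codes F q n k l)%N
      /\ (num_codes_pairs F q n k (c - 1) < num_codes_pairs F q n k c)%N).
Proof.
move=> q_pp cardF _ _ lt_lk lt_kn Dc.
have [a Dk] : exists a, k = (l + a.+1)%N
  by exists (k - l - 1)%N; lia.
have [b Dn] : exists b, (2 * l + a.+1 + b.+1 = n)%N
  by exists (n - k - l - 1)%N; lia.
have ratio := hull_count_ratio q_pp cardF Dn.
have D0 m : 0 < q%:R ^+ m.+1 - (-1) ^+ m.+1 :> rat.
  exact: signed_pow_gt0 (q_gt1 q_pp).
have Dpairs m :
    num_codes_pairs F q n k (n%:Z - k%:Z - m%:Z) = num_codes F q n k m.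
  apply: eq_card => C; rewrite !inE /ent_pairs; case: eqP => //= ->.
  by apply/eqP/eqP; lia.
have Dc1 : c - 1 = n%:Z - k%:Z - (l + 1)%N%:Z by lia.
rewrite Dc1 {}Dc !Dpairs addn1.
split=> [|not_exc].
  rewrite /alphaH Dk.
  have -> : (l + a.+1 - l = a.+1)%N by lia.
  have -> : (n - (l + a.+1) - l = b.+1)%N by lia.
  have -> : (n - 2 * l - 1 = (a + b).+1)%N by lia.
  apply: (mulIf (mulf_neq0 (lt0r_neq0 (D0 a)) (lt0r_neq0 (D0 b)))).
  rewrite ratio.
  have -> : q%:R ^+ 2 ^+ l.+1 - 1
            = (q%:R ^+ (l + 1) + 1) * (q%:R ^+ l.+1 - 1) :> rat.
    by rewrite addn1 exprAC; move: (q%:R ^+ l.+1 : rat) => L; ring.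
  have := mulf_neq0 (lt0r_neq0 (D0 a)) (lt0r_neq0 (D0 b)).
  move: (_ * _ : rat) (q%:R ^+ (l + 1) + 1 : rat) => D.
  rewrite /hull_count; move: (_%:R : rat) (q%:R ^+ l.+1 : rat).
  move: (q%:R ^+ (a + b).+1 : rat).
  by move=> X M Y Z D_neq0; field.
have Apos : 0 < hull_count F q n k l.+1 by apply: hull_count_gt0 => //; lia.
suff lt_num : (num_codes F q n k l.+1 < num_codes F q n k l)%N by [].
rewrite -(ltr_nat rat).
have D2 := mulr_gt0 (D0 a) (D0 b).
rewrite -!/(hull_count F q n k _) -(ltr_pM2r D2) Dk ratio -Dk (ltr_pM2l Apos).
have q0 : 0 < q%:R :> rat by rewrite ltr0n; exact: q_gt0 q_pp.
rewrite -(ltr_pM2r q0).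
have -> : q%:R ^+ (a + b).+1 * (q%:R ^+ 2 ^+ l.+1 - 1) * q%:R
          = q%:R ^+ a.+1 * q%:R ^+ b.+1 * (q%:R ^+ 2 ^+ l.+1 - 1) :> rat.
  by rewrite mulrAC -exprSr -exprD addSn addnS.
apply: signed_pow_bound => //; first exact: q_gt1 q_pp.
case=> q2 l0 even_ab ab1; apply: not_exc; split=> //; split.
  by rewrite -Dn l0 -addnA.
rewrite q2 Dk l0 !inE !xpair_eqE !eqxx /=.
by apply/orP; case/orP: ab1 => /eqP[ab1]; [left | right]; apply/eqP; lia.
Qed.
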